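(* Let $n\ge 2$ and fix any $k\in\{2,\ldots,n\}$. For any rational polyhedron $P\subseteq\mathbb{R}^n$, $$\mathcal{S}(P)=\bigcap_{L\in\mathcal{L}_k}\bigl(\mathcal{S}_L(P)+L^\perp\bigr).$$
   Context: A linear subspace $L\subseteq\mathbb{R}^n$ is a lattice subspace if $\operatorname{conv}(L\cap\mathbb{Z}^n)=L$; $\mathcal{L}_k$ is the set of all $k$-dimensional lattice subspaces of $\mathbb{R}^n$. $L^\perp$ is the orthogonal complement of $L$, and $\Lambda_L$ is the lattice in $L$ obtained as the orthogonal projection of $\mathbb{Z}^n$ onto $L$. For $X\subseteq L$, $\operatorname{int}_L(X)$ is the interior of $X$ in the relative topology of $L$. A halfspace in $L$ is a set $H\cap L$ with $H\subseteq\mathbb{R}^n$ a (closed) halfspace. A split set in $L$ with respect to $\Lambda_L$ is a set $S\subseteq L$ that is the intersection of two halfspaces in $L$, has the same dimension as $L$, and satisfies $\operatorname{int}_L(S)\cap\Lambda_L=\emptyset$. For a polyhedron $P\subseteq\mathbb{R}^n$, $P_L$ is the orthogonal projection of $P$ onto $L$, and the split closure of $P$ in $L$ with respect to $\Lambda_L$ is $$\mathcal{S}_L(P)=\bigcap_{\substack{S \text{ split set in } L\\ \text{with respect to }\Lambda_L}}\operatorname{conv}\bigl(P_L\setminus\operatorname{int}_L(S)\bigr).$$ $\mathcal{S}(P)$ denotes $\mathcal{S}_{\mathbb{R}^n}(P)$ (with $\Lambda_{\mathbb{R}^n}=\mathbb{Z}^n$). Equivalently, $\mathcal{S}(P)=\bigcap_{a\in\mathbb{Z}^n,K\in\mathbb{Z}}\operatorname{conv}\bigl(P\cap(\{x:\langle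 a,x\rangle\le K\}\cup\{x:\langle a,x\rangle\ge K+1\})\bigr)$. *)

(* Defs.v *)
From HB Require Import structures.
From mathcomp Require Import all_boot all_order all_algebra.
From mathcomp Require Import all_classical all_reals all_analysis.

Set Implicit Arguments.
Unset Strict Implicit.
Unset Printing Implicit Defensive.

Import Order.TTheory GRing.Theory Num.Theory.
Import numFieldNormedType.Exports.

Local Open Scope classical_set_scope.
Local Open Scope ring_scope.

(* R^n is 'rV[R]_n, linear subspaces of it are {vspace 'rV[R]_n}, and [set` L]
   is the set of points of L. *)

Section Geometry.
Context {R : realType} {n : nat}.
Implicit Types (X S P : set 'rV[R]_n) (L : {vspace 'rV[R]_n}).

Definition dot (u v : 'rV[R]_n) : R := \sum_(j < n) u 0 j * v 0 j.

Definition conv_hull X : set 'rV[R]_n := smallest (@convex_set R 'rV[R]_n) X.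

Definition integer_points : set 'rV[R]_n :=
  [set x | forall j, x 0 j \is a Num.int].

Definition lattice_subspace L : Prop :=
  conv_hull ([set` L] `&` integer_points) = [set` L].

Definition lattice_subspaces (k : nat) : set {vspace 'rV[R]_n} :=
  [set L | lattice_subspace L /\ \dim L = k].

Definition orth_compl L : set 'rV[R]_n :=
  [set y | forall z, z \in L -> dot y z = 0].

Definition orth_proj L X : set 'rV[R]_n :=
  [set y | y \in L /\ exists2 x, X x & orth_compl L (x - y)].

Definition proj_lattice L : set 'rV[R]_n := orth_proj L integer_points.

(* Points outside L are isolated in the library's topology on
   [subspace [set` L]]; this is harmless since [int_in L] is only applied to
   subsets of L. *)
Definition int_in L X : set 'rV[R]_n := @interior (subspace [set` L]) X.

Definition halfspace : set (set 'rV[R]_n) :=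
  [set H | exists (a : 'rV[R]_n) (c : R),
    a != 0 /\ H = [set x | dot a x <= c]].

Definition halfspace_in L : set (set 'rV[R]_n) :=
  [set H `&` [set` L] | H in halfspace].

Definition affine_subspace : set (set 'rV[R]_n) :=
  [set A | exists (p : 'rV[R]_n) (V : {vspace 'rV[R]_n}),
    A = [set p + v | v in [set` V]]].

Definition aff X : set 'rV[R]_n := smallest affine_subspace X.

(* X is nonempty and its affine hull has dimension d. *)
Definition has_dim X (d : nat) : Prop :=
  exists (p : 'rV[R]_n) (V : {vspace 'rV[R]_n}),
    [/\ X !=set0, \dim V = d & aff X = [set p + v | v in [set` V]]].

Definition split_set L S : Prop :=
  [/\ exists H1 H2, [/\ halfspace_in L H1, halfspace_in L H2 & S = H1 `&` H2],
      has_dim S (\dim L)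
    & int_in L S `&` proj_lattice L = set0].

Definition split_closure_in L P : set 'rV[R]_n :=
  \bigcap_(S in split_set L) conv_hull (orth_proj L P `\` int_in L S).

Definition split_closure P : set 'rV[R]_n := split_closure_in fullv P.

Definition rational_polyhedron P : Prop :=
  exists (m : nat) (A : 'M[rat]_(m, n)) (b : 'cV[rat]_m),
    P = [set x | forall i : 'I_m,
           \sum_(j < n) ratr (A i j) * x 0 j <= ratr (b i 0)].

Lemma orth_proj_fullv X : orth_proj fullv X = X.
Proof.
apply/seteqP; split=> [y [_ [x Xx yx]]|x Xx].
- suff -> : y = x by [].
  have := yx (x - y) (memvf _); rewrite /dot => /eqP.
  rewrite psumr_eq0 => [/allP h|j _]; last by rewrite -expr2 sqr_ge0.
  apply/rowP => j; have /= := h j (mem_index_enum _).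
  by rewrite mulf_eq0 orbb !mxE subr_eq0 => /eqP ->.
- split; first exact: memvf.
  by exists x => // z _; rewrite subrr /dot big1 // => j _; rewrite mxE mul0r.
Qed.

Lemma proj_lattice_fullv : proj_lattice fullv = integer_points.
Proof. exact: orth_proj_fullv. Qed.

End Geometry.

(* Main.v *)
Require Import Defs.
From mathcomp Require Import all_boot all_order all_algebra.
From mathcomp Require Import all_classical all_reals all_analysis.
From mathcomp Require Import ring lra zify.
Import Order.TTheory GRing.Theory Num.Theory.
Import numFieldNormedType.Exports.
Local Open Scope classical_set_scope.
Local Open Scope ring_scope.

(** A split set in [L] is cut out by two halfspaces with normals in [L], so
    adding the orthogonal complement of [L] turns it into a split set of R^n;
    this gives the inclusion from left to right.

    For the converse, a wedge with two non-antiparallel normals contains balls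
    of any radius, hence an integer point.  A split set of R^n therefore lies
    between two parallel hyperplanes, and since the values of its normal on the
    integer points avoid an interval they form a discrete group: the interior of
    the split set lies in a strip [K < w x < K + 1] with [w] integral.  By
    Balas's lifting and Fourier-Motzkin elimination, the hull of [P] minus this
    strip is a finite intersection of rational halfspaces [c x <= b].  As
    [2 <= k], each pair [w], [c] lies in some lattice subspace [L] of dimension
    [k], and there the strip is a split set, so [c x <= b] holds on
    [split_closure_in L P] plus the orthogonal complement of [L]. *)

(** * Inner product, orthogonal projection, relative interior *)

Section Dot.
Context {R : realType} {n : nat}.
Implicit Types (u v w x y : 'rV[R]_n) (L : {vspace 'rV[R]_n}).

Lemma dotC u v : dot u v = dot v u.
Proof. by apply: eq_bigr => j _; rewrite mulrC. Qed.

Lemma dotDr u v w : dot u (v + w) = dot u v + dot u w.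
Proof. by rewrite /dot -big_split; apply: eq_bigr => j _; rewrite mxE mulrDr. Qed.

Lemma dotZr t u v : dot u (t *: v) = t * dot u v.
Proof. by rewrite /dot mulr_sumr; apply: eq_bigr => j _; rewrite mxE mulrCA. Qed.

Lemma dotNr u v : dot u (- v) = - dot u v.
Proof. by rewrite -scaleN1r dotZr mulN1r. Qed.

Lemma dotBr u v w : dot u (v - w) = dot u v - dot u w.
Proof. by rewrite dotDr dotNr. Qed.

Lemma dot0r u : dot u 0 = 0.
Proof. by rewrite -(scale0r u) dotZr mul0r. Qed.

Lemma dotDl u v w : dot (v + w) u = dot v u + dot w u.
Proof. by rewrite dotC dotDr !(dotC u). Qed.

Lemma dotZl t u v : dot (t *: v) u = t * dot v u.
Proof. by rewrite dotC dotZr (dotC u). Qed.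

Lemma dotNl u v : dot (- v) u = - dot v u.
Proof. by rewrite dotC dotNr dotC. Qed.

Lemma dotBl u v w : dot (v - w) u = dot v u - dot w u.
Proof. by rewrite dotDl dotNl. Qed.

Lemma dot0l u : dot 0 u = 0.
Proof. by rewrite dotC dot0r. Qed.

Lemma dot_ge0 u : 0 <= dot u u.
Proof. by apply: sumr_ge0 => j _; rewrite -expr2 sqr_ge0. Qed.

Lemma dot_eq0 u : (dot u u == 0) = (u == 0).
Proof.
apply/idP/eqP => [|->]; last by rewrite dot0r.
rewrite psumr_eq0 => [/allP h|j _]; last by rewrite -expr2 sqr_ge0.
apply/rowP => j; have /= := h j (mem_index_enum _).
by rewrite mulf_eq0 orbb mxE => /eqP.
Qed.

Lemma dot_gt0 u : (0 < dot u u) = (u != 0).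
Proof. by rewrite lt_def dot_ge0 andbT dot_eq0. Qed.

Lemma dot_int u v : integer_points u -> integer_points v ->
  dot u v \is a Num.int.
Proof. by move=> uZ vZ; apply: rpred_sum => j _; apply: rpredM. Qed.

Lemma dot_delta u j : dot u (delta_mx 0 j) = u 0 j.
Proof.
rewrite /dot (bigD1 j)//= mxE !eqxx mulr1 big1 ?addr0// => i /negPf ij.
by rewrite mxE ij andbF mulr0.
Qed.

(** Gram-Schmidt along a spanning list: [w] is the part of the new vector [v] orthogonal to the
    previous ones, and [t] makes the residue of [x] orthogonal to [w]. *)
Lemma orth_proj_exists L x : exists2 u, u \in L & orth_compl L (x - u).
Proof.
have [s ->] : exists s : seq 'rV[R]_n, L = span s.
  by exists (vbasis L); rewrite (span_basis (vbasisP L)).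
elim: s => [|v s IH] in x *.
  exists 0; first exact: mem0v.
  by move=> z; rewrite span_nil memv0 => /eqP ->; rewrite dot0r.
have [u us ux] := IH x; have [v1 v1s v1v] := IH v.
pose w := v - v1; pose t := dot x w / dot w w; exists (t *: v + (u - t *: v1)).
  by rewrite span_cons memv_add ?memvZ ?memv_line// memvB// memvZ.
have -> : t *: v + (u - t *: v1) = u + t *: w by rewrite scalerBr addrCA.
move=> z; rewrite span_cons => /memv_addP[_ /vlineP[k ->] [z' z's ->]].
have E y : y \in span s -> dot (x - (u + t *: w)) y = 0.
  by move=> ys; rewrite opprD addrA dotBl ux// dotZl v1v// mulr0 subr0.
rewrite dotDr (E _ z's) addr0 dotZr -(subrK v1 v) dotDr -/w (E _ v1s) addr0.
rewrite dotBl dotDl dotZl [dot u w]dotC v1v// add0r /t.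
have [->|w0] := eqVneq w 0; first by rewrite !dot0r mulr0 subrr mulr0.
by rewrite divfK ?subrr ?mulr0 ?dot_eq0.
Qed.

Lemma orth_compl_uniq L x u v : u \in L -> v \in L ->
  orth_compl L (x - u) -> orth_compl L (x - v) -> u = v.
Proof.
move=> uL vL xu xv; apply/eqP; rewrite -subr_eq0 -dot_eq0.
have {1}-> : u - v = (x - v) - (x - u) by rewrite opprB [RHS]addrC addrA subrK.
by rewrite dotBl xu ?xv ?subrr// memvB.
Qed.

Lemma dot_orth_proj L a x u : a \in L -> orth_compl L (x - u) ->
  dot a u = dot a x.
Proof.
by move=> aL /(_ a aL) /eqP; rewrite dotBl subr_eq0 !(dotC a) => /eqP ->.
Qed.

Lemma int_inE L X y : y \in L ->
  int_in L X y = nbhs y [set x | x \in L -> X x].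
Proof.
move=> yL; symmetry.
exact: (f_equal (@^~ X) (@nbhs_subspace_in _ [set` L] y yL)).
Qed.

Lemma halfspaces_sub_int_in L X a b c d y : y \in L ->
  dot a y < c -> dot b y < d ->
  (forall x, x \in L -> dot a x < c -> dot b x < d -> X x) -> int_in L X y.
Proof.
move=> yL ac bd LX; rewrite int_inE//.
have dot_near (w : 'rV[R]_n) r : dot w y < r -> \forall x \near y, dot w x < r.
  move=> wr; pose S := \sum_j `|w 0 j|.
  have S0 : 0 <= S by apply: sumr_ge0.
  apply/nbhs_ballP; exists ((r - dot w y) / (1 + S)).
    by rewrite /= divr_gt0 ?subr_gt0 ?ltr_pwDl.
  move=> x [e0 yx]; rewrite -(subrK y x) dotDr -ltrBrDr.
  suff : dot w (x - y) <= S * ((r - dot w y) / (1 + S)).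
    move/le_lt_trans; apply; rewrite mulrA ltr_pdivrMr ?ltr_pwDl//.
    by rewrite mulrC ltr_pM2l ?subr_gt0// ltrDr.
  rewrite /dot mulr_suml; apply: ler_sum => j _.
  rewrite (le_trans (ler_norm _))// normrM ler_wpM2l// ltW// !mxE distrC.
  by have := yx 0 j; rewrite -ball_normE.
near=> x => xL; apply: LX => //; near: x; exact: dot_near.
Unshelve. all: by end_near. Qed.

(** The form in which interiority is used: [v = 0] gives membership, a normal vector gives a strict
    inequality, and [v = x - y] gives a second point on the line to [x]. *)
Lemma int_in_perturb L X y v : y \in L -> v \in L -> int_in L X y ->
  exists2 e, 0 < e & X (y + e *: v).
Proof.
move=> yL vL; rewrite int_inE// => /nbhs_ballP.
move=> [e/= e0 yX].
have S0 : 0 <= \sum_j `|v 0 j| by apply: sumr_ge0.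
have t0 : 0 < e / (1 + \sum_j `|v 0 j|) by rewrite divr_gt0// ltr_pwDl.
exists (e / (1 + \sum_j `|v 0 j|)) => //; apply: yX; last by rewrite memvD// memvZ.
split=> // i j; rewrite ord1 -ball_normE /= !mxE opprD addrA subrr sub0r normrN.
rewrite normrM gtr0_norm// mulrAC ltr_pdivrMr ?ltr_pwDl// ltr_pM2l//.
rewrite (bigD1 j)//= addrCA ltrDl ltr_pwDl//; exact: sumr_ge0.
Qed.

End Dot.

(** * Convex hulls *)

Section ConvexHull.
Context {R : realType} {n : nat}.
Implicit Types (X Y : set 'rV[R]_n) (x y : 'rV[R]_n).

Lemma convex_setE Y : @convex_set R 'rV[R]_n Y <->
  forall x y t, Y x -> Y y -> 0 <= t -> t <= 1 -> Y (t *: x + (1 - t) *: y).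
Proof.
split=> [cY x y t Yx Yy t0 t1|cY x y t].
  have := cY x y (Itv01 t0 t1); rewrite !inE; exact.
by rewrite !inE => Yx Yy; apply: cY.
Qed.

Lemma sub_conv_hull X : X `<=` conv_hull X.
Proof. exact: sub_smallest. Qed.

Lemma conv_hull_min X Y :
  (forall x y t, Y x -> Y y -> 0 <= t -> t <= 1 -> Y (t *: x + (1 - t) *: y)) ->
  X `<=` Y -> conv_hull X `<=` Y.
Proof. by move=> /convex_setE cY XY; apply: smallest_sub. Qed.

Lemma conv_hull_convex X x y t : conv_hull X x -> conv_hull X y ->
  0 <= t -> t <= 1 -> conv_hull X (t *: x + (1 - t) *: y).
Proof.
move=> Xx Xy t0 t1 Y YX; have /convex_setE := YX.1.
by apply=> //; [exact: Xx | exact: Xy].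
Qed.

Lemma conv_hull_mono X Y : X `<=` Y -> conv_hull X `<=` conv_hull Y.
Proof.
move=> XY; apply: conv_hull_min; first by move=> *; exact: conv_hull_convex.
exact: subset_trans XY (@sub_conv_hull Y).
Qed.

Lemma conv_hull_halfspace X (a : 'rV[R]_n) (c : R) :
  X `<=` [set x | dot a x <= c] -> conv_hull X `<=` [set x | dot a x <= c].
Proof.
apply: conv_hull_min => x y t /= xc yc t0 t1; rewrite dotDr !dotZr.
have t1' : 0 <= 1 - t by rewrite subr_ge0.
have := ler_wpM2l t0 xc; have := ler_wpM2l t1' yc; lra.
Qed.

End ConvexHull.

(** * Fourier-Motzkin elimination with rational coefficients *)

Section Elimination.
Context {R : realType}.

(** Negative [al j] bound [t] from below, positive ones from above, and the hypothesis on pairs puts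
    each lower bound under each upper bound. So the largest lower bound works, or the smallest upper
    bound if there is no lower one. *)
Lemma linear_ineqs_solvable (I : finType) (a al : I -> R) :
  (forall i, al i = 0 -> a i <= 0) ->
  (forall i j, 0 < al i -> al j < 0 -> - al j * a i + al i * a j <= 0) ->
  exists t, forall i, a i + al i * t <= 0.
Proof.
move=> h0 hpn; case: (pickP (fun j => al j < 0)) => [j0 j0n|nn].
  case: (@arg_maxP _ R I j0 (fun j => al j < 0) (fun j => - a j / al j) j0n) => j jn jmax.
  exists (- a j / al j) => i; case: (ltgtP (al i) 0) => [i0|i0|i0].
  - by rewrite addrC -lerBrDr sub0r -ler_ndivrMl// mulrC; exact: jmax.
  - rewrite -(@pmulr_rle0 _ (- al j)) ?oppr_gt0//.
    rewrite (le_trans _ (hpn i j i0 jn))//.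
    by rewrite le_eqVlt; apply/orP; left; apply/eqP; field; rewrite lt_eqF.
  - by rewrite i0 mul0r addr0 h0.
case: (pickP (fun j => 0 < al j)) => [j0 j0p|np].
  case: (@arg_minP _ R I j0 (fun j => 0 < al j) (fun j => - a j / al j) j0p) => j jp jmin.
  exists (- a j / al j) => i; case: (ltgtP (al i) 0) => [i0|i0|i0].
  - by have := nn i; rewrite i0.
  - by rewrite addrC -lerBrDr sub0r -ler_pdivlMl// [leRHS]mulrC; exact: jmin.
  - by rewrite i0 mul0r addr0 h0.
exists 0 => i; rewrite mulr0 addr0 h0//.
by apply/eqP; rewrite eq_le !leNgt np nn.
Qed.

(** This closure is what eliminating a variable uses; keeping [E] and [F] abstract lets the
    elimination be iterated over [E * R]. *)
Definition rat_cone {E : Type} (F : set (E -> R)) :=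
  F (fun=> 0) /\ forall f g (r s : rat), F f -> F g -> 0 <= r -> 0 <= s ->
    F (fun e => ratr r * f e + ratr s * g e).

Definition cut_out_by {E : Type} (F : set (E -> R)) (X : set E) :=
  exists (I : finType) (f : I -> E -> R),
    (forall i, F (f i)) /\ X = [set e | forall i, f i e <= 0].

Lemma fourier_motzkin {E : Type} (F : set (E -> R)) (I : finType)
    (f : I -> E -> R) (al : I -> rat) : rat_cone F -> (forall i, F (f i)) ->
  cut_out_by F [set e | exists t, forall i, f i e + ratr (al i) * t <= 0].
Proof.
move=> [F0 FD] Ff.
(* Constraints free of [t] are kept, pairs of opposite sign are combined so that [t] cancels, and
   all other indices carry the void constraint [0 <= 0]. *)
pose g (k : I + I * I) : E -> R := match k with
  | inl i => if al i == 0 then f i else fun=> 0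
  | inr (i, j) => if (0 < al i) && (al j < 0)
      then fun e => ratr (- al j) * f i e + ratr (al i) * f j e else fun=> 0
  end.
exists (I + I * I)%type, g; split=> [[i|[i j]]/=|].
- by case: ifP.
- by case: ifP => // /andP[i0 j0]; apply: FD => //; rewrite ?oppr_ge0 ltW.
apply/seteqP; split=> [e [t et] [i|[i j]]/=|e eg].
- by case: eqP => // i0; have := et i; rewrite i0 rmorph0 mul0r addr0.
- case: ifP => // /andP[i0 j0]; rewrite rmorphN/=.
  have {}i0 : 0 < ratr (al i) :> R by rewrite ltr0q.
  have {}j0 : ratr (al j) < 0 :> R by rewrite ltrq0.
  have := ler_wnM2l (ltW j0) (et i); have := ler_wpM2l (ltW i0) (et j); lra.
- apply: linear_ineqs_solvable => [i /eqP|i j].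
    by rewrite fmorph_eq0 => i0; have := eg (inl i); rewrite /= i0.
  rewrite ltr0q ltrq0 => i0 j0; have := eg (inr (i, j)).
  by rewrite /= i0 j0 /= rmorphN.
Qed.

(** Induction on [p] for all [E]: the first unknown is absorbed into the point, now in [E * R], the
    others are eliminated there, and the absorbed one goes last. *)
Lemma fourier_motzkin_iter {E : Type} (F : set (E -> R)) (p : nat) (I : finType)
    (f : I -> E -> R) (al : I -> 'I_p -> rat) :
  rat_cone F -> (forall i, F (f i)) ->
  cut_out_by F
    [set e | exists y : 'I_p -> R,
      forall i, f i e + \sum_j ratr (al i j) * y j <= 0].
Proof.
elim: p => [|p IH] in E F I f al * => F_cone Ff.
  exists I, f; split=> //; apply/seteqP; split=> e /=.
    by move=> [y ey] i; have := ey i; rewrite big_ord0 addr0.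
  by move=> ei; exists (fun=> 0) => i; rewrite big_ord0 addr0.
pose G : set (E * R -> R) :=
  [set g | exists f a, F f /\ g = fun u => f u.1 + ratr a * u.2].
have G_cone : rat_cone G.
  case: (F_cone) => F0 FD; split.
    exists (fun=> 0), 0; split=> //; apply/funext => u.
    by rewrite rmorph0 mul0r addr0.
  move=> _ _ r s [g1 [a1 [Fg1 ->]]] [g2 [a2 [Fg2 ->]]] r0 s0.
  exists (fun e => ratr r * g1 e + ratr s * g2 e), (r * a1 + s * a2).
  split; first exact: FD.
  by apply/funext => u; rewrite rmorphD !rmorphM/=; ring.
pose h i (u : E * R) := f i u.1 + ratr (al i ord0) * u.2.
have Gh i : G (h i) by exists (f i), (al i ord0).
have [J [g [Gg gE]]] := IH _ _ I h (fun i j => al i (lift ord0 j)) G_cone Gh.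
have /choice[f1 /choice[a1 fa]] : forall j, exists f a,
  F f /\ g j = fun u => f u.1 + ratr a * u.2 by exact: Gg.
have [K [k [Fk kE]]] := @fourier_motzkin E F J f1 a1 F_cone (fun j => (fa j).1).
exists K, k; split=> //; rewrite -kE; apply/seteqP; split=> e /=.
  move=> [y ey]; exists (y ord0) => j.
  suff : [set u : E * R | forall i, g i u <= 0] (e, y ord0).
    by move/(_ j); rewrite /= (fa j).2.
  rewrite -gE; exists (fun j => y (lift ord0 j)) => i.
  by have := ey i; rewrite big_ord_recl addrA.
move=> [t et].
have : [set u : E * R | forall i, g i u <= 0] (e, t).
  by move=> j; rewrite (fa j).2 /= et.
rewrite -gE => -[y ey].
exists (fun k => if unlift ord0 k is Some j then y j else t) => i.
rewrite big_ord_recl unlift_none addrA.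
by under eq_bigr => j _ do rewrite liftK; exact: ey.
Qed.

End Elimination.

(** * The hull of a rational polyhedron minus a strip *)

Section RationalPolyhedra.
Context {R : realType} {n : nat}.
Implicit Types (x y : 'rV[R]_n) (P : set 'rV[R]_n) (c w : 'rV[rat]_n).

Definition ratv c : 'rV[R]_n := map_mx ratr c.

Definition rat_affine : set ('rV[R]_n -> R) :=
  [set f | exists c b, f = fun x => dot (ratv c) x - ratr b].

Lemma dot_ratv_comb c1 c2 (r s : rat) x :
  dot (ratv (r *: c1 + s *: c2)) x =
  ratr r * dot (ratv c1) x + ratr s * dot (ratv c2) x.
Proof. by rewrite /ratv map_mxD !map_mxZ dotDl !dotZl. Qed.

Lemma dot_ratvN c x : dot (ratv (- c)) x = - dot (ratv c) x.
Proof. by rewrite /ratv map_mxN dotNl. Qed.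

Lemma dot_ratv0 x : dot (ratv 0) x = 0.
Proof. by rewrite /ratv map_mx0 dot0l. Qed.

(* The set below is the projection to the first factor of the homogenized
   description of [t P1 + (1 - t) P2], where [Pk] is cut out by [ck], [bk]. *)
Lemma rat_affine_hull (I1 I2 : finType) (c1 : I1 -> 'rV[rat]_n) (b1 : I1 -> rat)
    (c2 : I2 -> 'rV[rat]_n) (b2 : I2 -> rat) :
  cut_out_by rat_affine [set x | exists x1 t, [/\ 0 <= t <= 1,
    forall i, dot (ratv (c1 i)) x1 <= t * ratr (b1 i) &
    forall i, dot (ratv (c2 i)) (x - x1) <= (1 - t) * ratr (b2 i)]].
Proof.
have ra_cone : rat_cone rat_affine.
  split=> [|_ _ r s [c [b ->]] [c' [b' ->]] _ _].
    by exists 0, 0; apply/funext => x; rewrite dot_ratv0 rmorph0 subr0.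
  exists (r *: c + s *: c'), (r * b + s * b'); apply/funext => x.
  by rewrite dot_ratv_comb rmorphD !rmorphM/=; ring.
pose F : set ('rV[R]_n * 'rV[R]_n -> R) := [set f | exists c d b,
  f = fun u => dot (ratv c) u.1 + dot (ratv d) u.2 - ratr b].
have F_cone : rat_cone F.
  split=> [|_ _ r s [c [d [b ->]]] [c' [d' [b' ->]]] _ _].
    exists 0, 0, 0; apply/funext => u.
    by rewrite !dot_ratv0 rmorph0 addr0 subr0.
  exists (r *: c + s *: c'), (r *: d + s *: d'), (r * b + s * b').
  by apply/funext => u; rewrite !dot_ratv_comb rmorphD !rmorphM/=; ring.
(* With [u = (x, x1)], each [k] encodes [g k u + al k * t <= 0]; the two [inr] constraints are
   [0 <= t] and [t <= 1]. *)
pose g (k : I1 + I2 + bool) : 'rV[R]_n * 'rV[R]_n -> R := match k with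
  | inl (inl i) => fun u => dot (ratv (c1 i)) u.2
  | inl (inr i) => fun u => dot (ratv (c2 i)) (u.1 - u.2) - ratr (b2 i)
  | inr true => fun=> 0
  | inr false => fun=> - 1
  end.
pose al (k : I1 + I2 + bool) : rat := match k with
  | inl (inl i) => - b1 i
  | inl (inr i) => b2 i
  | inr true => - 1
  | inr false => 1
  end.
have Fg k : F (g k).
  case: k => [[i|i]|[]]; rewrite /g.
  - exists 0, (c1 i), 0; apply/funext => u.
    by rewrite dot_ratv0 rmorph0 add0r subr0.
  - exists (c2 i), (- c2 i), (b2 i); apply/funext => u.
    by rewrite dot_ratvN dotBr.
  - by case: F_cone.
  - exists 0, 0, 1; apply/funext => u.
    by rewrite !dot_ratv0 rmorph1 !add0r.
have [J [h [Fh hE]]] := fourier_motzkin F _ g al F_cone Fg.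
have /choice[c /choice[d /choice[b hcdb]]] : forall j, exists c d b,
  h j = fun u => dot (ratv c) u.1 + dot (ratv d) u.2 - ratr b by exact: Fh.
pose f j x := dot (ratv (c j)) x - ratr (b j).
have [K [k [Fk kE]]] := fourier_motzkin_iter rat_affine n J f (fun j => d j 0)
  ra_cone (fun j => ex_intro _ (c j) (ex_intro _ (b j) erefl)).
exists K, k; split=> //; rewrite -kE; apply/seteqP; split=> x /=.
  move=> [x1 [t [/andP[t0 t1] h1 h2]]]; exists (x1 0) => j.
  suff : [set u | forall i, h i u <= 0] (x, x1).
    move=> /(_ j); rewrite hcdb /= addrAC /f /dot.
    by under [X in _ + X <= _ -> _]eq_bigr do rewrite mxE.
  rewrite -hE; exists t => -[[i|i]|[]] /=.
  - by rewrite rmorphN/=; have := h1 i; lra.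
  - by have := h2 i; lra.
  - by rewrite rmorphN rmorph1; lra.
  - by rewrite rmorph1; lra.
move=> [y xy]; pose x1 : 'rV[R]_n := \row_j y j.
have : [set u | forall i, h i u <= 0] (x, x1).
  move=> j; have := xy j; rewrite hcdb /= [in X in _ -> X]addrAC /f /dot.
  by under [X in _ -> _ + X <= _]eq_bigr do rewrite !mxE.
rewrite -hE => -[t xt]; exists x1, t; split=> [|i|i].
- have := xt (inr true); have := xt (inr false).
  by rewrite /= rmorphN rmorph1 => ? ?; apply/andP; split; lra.
- by have := xt (inl (inl i)); rewrite /= rmorphN; lra.
- by have := xt (inl (inr i)); rewrite /=; lra.
Qed.

Lemma split_hull P w (K K' : rat) : rational_polyhedron P -> K < K' ->
  exists Q, [/\ cut_out_by rat_affine Q,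
    P `&` [set x | dot (ratv w) x <= ratr K \/ ratr K' <= dot (ratv w) x] `<=` Q
    & Q `<=` conv_hull (P `&`
       [set x | dot (ratv w) x <= ratr K \/ ratr K' <= dot (ratv w) x])].
Proof.
move=> [m [A [b ->]]] KK'; set P' := [set x | _] `&` _.
pose c1 (o : option 'I_m) := if o is Some i then row i A else w.
pose b1 (o : option 'I_m) := if o is Some i then b i 0 else K.
pose c2 (o : option 'I_m) := if o is Some i then row i A else - w.
pose b2 (o : option 'I_m) := if o is Some i then b i 0 else - K'.
have rowE i x : dot (ratv (row i A)) x = \sum_(j < n) ratr (A i j) * x 0 j.
  by rewrite /dot; apply: eq_bigr => j _; rewrite !mxE.
exists [set x | exists x1 t, [/\ 0 <= t <= 1,
    forall o, dot (ratv (c1 o)) x1 <= t * ratr (b1 o) &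
    forall o, dot (ratv (c2 o)) (x - x1) <= (1 - t) * ratr (b2 o)]].
split; first exact: rat_affine_hull.
  move=> x [/= xP [xK|xK']].
    exists x, 1; split=> [|[i|]|o]; rewrite ?ler01 ?lexx ?mul1r//=.
    - by rewrite rowE.
    - by rewrite !subrr dot0r mul0r.
  exists 0, 0; split=> [|o|[i|]]; rewrite ?ler01 ?lexx ?mul0r ?dot0r//=.
  - by rewrite !subr0 mul1r rowE.
  - by rewrite !subr0 mul1r dot_ratvN rmorphN lerN2.
have cvP x : (forall i, dot (ratv (row i A)) x <= ratr (b i 0)) ->
    dot (ratv w) x <= ratr K \/ ratr K' <= dot (ratv w) x -> conv_hull P' x.
  move=> xP xw; apply: sub_conv_hull; split=> //= i.
  by rewrite -rowE.
have {}KK' : ratr K < ratr K' :> R by rewrite ltr_rat.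
have ray y v s : 1 <= s -> conv_hull P' y -> conv_hull P' (y + s *: v) ->
    conv_hull P' (y + v).
  move=> s1 Py Ps; have s0 : 0 < s by rewrite (lt_le_trans ltr01).
  have -> : y + v = s^-1 *: (y + s *: v) + (1 - s^-1) *: y.
    rewrite scalerDr scalerA mulVf ?gt_eqF// scale1r scalerBl scale1r.
    by rewrite [RHS]addrAC subrKC.
  by apply: conv_hull_convex => //; rewrite ?invr_ge0 ?invf_le1// ltW.
move=> x [x1 [t [/andP[t0 t1] h1 h2]]].
have [t_eq0|t_neq0] := eqVneq t 0.
  (* [x1] is a recession direction of [P]; unless it is parallel to the split,
     following it from [x - x1] leads to the side [w <= K]. *)
  pose y := x - x1; have -> : x = y + x1 by rewrite subrK.
  have v_rec i : dot (ratv (row i A)) x1 <= 0.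
    by have := h1 (Some i); rewrite t_eq0 mul0r.
  have vw : dot (ratv w) x1 <= 0 by have := h1 None; rewrite t_eq0 mul0r.
  have yP i : dot (ratv (row i A)) y <= ratr (b i 0).
    by have := h2 (Some i); rewrite t_eq0 subr0 mul1r.
  have yw : ratr K' <= dot (ratv w) y.
    by have := h2 None; rewrite t_eq0 subr0 mul1r /= dot_ratvN rmorphN lerN2.
  have [vw0|vw0] := eqVneq (dot (ratv w) x1) 0.
    apply: cvP => [i|]; last by right; rewrite dotDr vw0 addr0.
    by rewrite dotDr -[leRHS]addr0 lerD.
  have {}vw0 : dot (ratv w) x1 < 0 by rewrite lt_neqAle vw0.
  have r0 : 0 <= (dot (ratv w) y - ratr K) / - dot (ratv w) x1.
    by rewrite divr_ge0//; lra.
  (* The second summand alone brings [w] down from its value at [y] to [K]; the [1] makes the factor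
     at least 1, as [ray] requires. *)
  apply: (ray _ _ (1 + (dot (ratv w) y - ratr K) / - dot (ratv w) x1)).
  - by rewrite lerDl.
  - by apply: cvP => //; right.
  apply: cvP => [i|].
    rewrite dotDr dotZr -[leRHS]addr0 lerD// mulr_ge0_le0// addr_ge0//.
  left; rewrite dotDr dotZr mulrDl mul1r invrN mulrN mulNr divfK ?lt_eqF//; lra.
have [t_eq1|t_neq1] := eqVneq t 1.
  pose v := x - x1; have -> : x = x1 + v by rewrite addrC subrK.
  have v_rec i : dot (ratv (row i A)) v <= 0.
    by have := h2 (Some i); rewrite t_eq1 subrr mul0r.
  have vw : 0 <= dot (ratv w) v.
    by have := h2 None; rewrite t_eq1 subrr mul0r /= dot_ratvN oppr_le0.
  have yP i : dot (ratv (row i A)) x1 <= ratr (b i 0).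
    by have := h1 (Some i); rewrite t_eq1 mul1r.
  have yw : dot (ratv w) x1 <= ratr K.
    by have := h1 None; rewrite t_eq1 mul1r.
  have [vw0|vw0] := eqVneq (dot (ratv w) v) 0.
    apply: cvP => [i|]; last by left; rewrite dotDr vw0 addr0.
    by rewrite dotDr -[leRHS]addr0 lerD.
  have {}vw0 : 0 < dot (ratv w) v by rewrite lt_neqAle eq_sym vw0.
  have r0 : 0 <= (ratr K' - dot (ratv w) x1) / dot (ratv w) v.
    by rewrite divr_ge0//; lra.
  apply: (ray _ _ (1 + (ratr K' - dot (ratv w) x1) / dot (ratv w) v)).
  - by rewrite lerDl.
  - by apply: cvP => //; left.
  apply: cvP => [i|].
    rewrite dotDr dotZr -[leRHS]addr0 lerD// mulr_ge0_le0// addr_ge0//.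
  right; rewrite dotDr dotZr mulrDl mul1r divfK ?gt_eqF//; lra.
have {t_neq0}t0 : 0 < t by rewrite lt_neqAle eq_sym t_neq0.
have {t_neq1}t1 : 0 < 1 - t by rewrite subr_gt0 lt_neqAle t_neq1.
have -> : x = t *: (t^-1 *: x1) + (1 - t) *: ((1 - t)^-1 *: (x - x1)).
  by rewrite !scalerA !mulfV ?gt_eqF// !scale1r addrC subrK.
have y1P o : dot (ratv (c1 o)) (t^-1 *: x1) <= ratr (b1 o).
  by rewrite dotZr ler_pdivrMl.
have y2P o : dot (ratv (c2 o)) ((1 - t)^-1 *: (x - x1)) <= ratr (b2 o).
  by rewrite dotZr ler_pdivrMl.
apply: conv_hull_convex; [| |exact: ltW|lra]; apply: cvP => [i|].
- exact: (y1P (Some i)).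
- by left; exact: (y1P None).
- exact: (y2P (Some i)).
- by right; have := y2P None; rewrite /= dot_ratvN rmorphN lerN2.
Qed.
End RationalPolyhedra.

(** * Integer points in wedges and slabs *)

Section IntegerFreeSlabs.
Context {R : realType} {n : nat}.
Implicit Types (a b v x z : 'rV[R]_n).

(** Far out along [v] both forms are very negative, and rounding the coordinates down changes a form
    [u] by at most [S u]. *)
Lemma wedge_integer_point a b v (c d : R) : dot a v < 0 -> dot b v < 0 ->
  exists z, [/\ integer_points z, dot a z < c & dot b z < d].
Proof.
move=> av bv; pose S (u : 'rV[R]_n) := \sum_j `|u 0 j|.
pose t := 1 + `|c - S a| / - dot a v + `|d - S b| / - dot b v.
pose z : 'rV[R]_n := \row_j (Num.floor (t * v 0 j))%:~R.
have zS u : dot u z <= t * dot u v + S u.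
  rewrite -dotZr -lerBlDl -dotBr /dot /S; apply: ler_sum => j _.
  rewrite (le_trans (ler_norm _))// normrM ler_piMr// !mxE distrC.
  have /andP[h1 h2] := floor_itv (t * v 0 j); rewrite ger0_norm ?subr_ge0//.
  by rewrite lerBlDl ltW// -[X in _ + X]/(1%:~R) -intrD.
have bound (u : 'rV[R]_n) r : dot u v < 0 -> 1 + `|r - S u| / - dot u v <= t ->
    dot u z < r.
  move=> uv ut; apply: le_lt_trans (zS u) _.
  have : (1 + `|r - S u| / - dot u v) * - dot u v <= t * - dot u v.
    by rewrite ler_wpM2r// oppr_ge0 ltW.
  rewrite mulrDl divfK ?oppr_eq0 ?lt_eqF//; have := ler_norm (S u - r).
  by rewrite distrC; lra.
exists z; split; first by move=> j; rewrite mxE intr_int.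
- by apply: bound => //; rewrite lerDl divr_ge0// oppr_ge0 ltW.
- by apply: bound => //; rewrite /t addrAC lerDl divr_ge0// oppr_ge0 ltW.
Qed.

(** [w] is the part of [b] orthogonal to [a]. If it is nonzero, [- a] minus a large multiple of [w]
    decreases both forms; if it is zero, [b] is a multiple of [a], negative because otherwise [- a]
    decreases both. *)
Lemma no_common_descent a b : a != 0 -> b != 0 ->
  (forall v, dot a v < 0 -> dot b v < 0 -> False) ->
  exists2 mu, 0 < mu & b = - mu *: a.
Proof.
move=> a0 b0 nodesc; have aa : 0 < dot a a by rewrite dot_gt0.
pose mu := - (dot b a / dot a a); pose w := b + mu *: a.
have wa : dot w a = 0.
  by rewrite dotDl dotZl mulNr divfK ?gt_eqF// subrr.
have [w0|w0] := eqVneq w 0.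
  have bE : b = - mu *: a.
    by rewrite scaleNr; apply/eqP; rewrite -addr_eq0; apply/eqP.
  exists mu => //; rewrite lt_neqAle; apply/andP; split.
    by apply: contra_neq b0 => mu0; rewrite bE -mu0 oppr0 scale0r.
  rewrite leNgt; apply/negP => mu0; apply: (nodesc (- a)).
    by rewrite dotNr oppr_lt0.
  by rewrite bE dotZl dotNr mulrN mulNr opprK nmulr_rlt0.
have ww : 0 < dot w w by rewrite dot_gt0.
case: (nodesc (- a - ((1 + `|dot b a|) / dot w w) *: w)).
  by rewrite dotBr dotZr dotNr (dotC a w) wa mulr0 subr0 oppr_lt0.
rewrite dotBr dotZr dotNr.
have -> : dot b w = dot w w.
  by rewrite {2}/w dotDl dotZl (dotC a w) wa mulr0 addr0.
by rewrite divfK ?gt_eqF//; have := ler_norm (- dot b a); rewrite normrN; lra.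
Qed.

Lemma integer_points_delta j : integer_points (delta_mx 0 j : 'rV[R]_n).
Proof. by move=> i; rewrite mxE rpred_nat. Qed.

Lemma integer_pointsB x y : integer_points x -> integer_points y ->
  integer_points (x - y).
Proof. by move=> xZ yZ j; rewrite !mxE rpredB. Qed.

Lemma integer_pointsZ (k : int) x : integer_points x ->
  integer_points (k%:~R *: x).
Proof. by move=> xZ j; rewrite mxE rpredM// intr_int. Qed.

(** The values of [a] at integer points form a subgroup of the reals; avoiding a nonempty interval,
    it has a least positive element [g]. Then [a / g] is integral and the slab lies between
    consecutive multiples of [g]. *)
Lemma integer_free_slab a (c c' : R) : a != 0 ->
  (forall z, integer_points z -> c' < dot a z -> dot a z < c -> False) ->
  exists (w : 'rV[int]_n) (K : int), w != 0 /\
    forall x, c' < dot a x -> dot a x < c ->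
      K%:~R < dot (map_mx intr w) x < (K + 1)%:~R.
Proof.
move=> a0 free; have [j aj] : exists j, a 0 j != 0.
  apply/existsP; apply: contraNT a0; rewrite negb_exists => /forallP h.
  by apply/eqP/rowP => j; have := h j; rewrite negbK mxE => /eqP.
have [cc'|c'c] := leP c c'.
  exists (delta_mx 0 j), 0; split=> [|x h1 h2]; last first.
    by have := lt_trans h1 h2; rewrite ltNge cc'.
  by apply/eqP => /rowP /(_ j); rewrite !mxE !eqxx.
(* A positive value below the width of the slab would have a multiple inside the slab. *)
have gap z : integer_points z -> 0 < dot a z -> c - c' <= dot a z.
  move=> zZ z0; rewrite leNgt; apply/negP => zl.
  have /andP[k1 k2] := floor_itv (c' / dot a z); set k := Num.floor _ in k1 k2.
  apply: (free _ (integer_pointsZ (k + 1) _ zZ)); rewrite dotZr.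
    by rewrite -ltr_pdivrMr.
  by move: k1; rewrite ler_pdivlMr// intrD mulrDl mul1r; lra.
have [z0 [z0Z z0_gt0]] : exists z, integer_points z /\ 0 < dot a z.
  have [aj0|aj0] := ltP 0 (a 0 j).
    exists (delta_mx 0 j); rewrite dot_delta; split=> //.
    exact: integer_points_delta.
  exists (0 - delta_mx 0 j); split.
    by apply: integer_pointsB (integer_points_delta j) => i; rewrite mxE rpred0.
  by rewrite sub0r dotNr dot_delta oppr_gt0 lt_neqAle aj.
have {z0 z0Z z0_gt0} [z0 [z0Z z0_gt0 z0_min]] : exists z0,
    [/\ integer_points z0, 0 < dot a z0 &
      forall z, integer_points z -> 0 < dot a z -> dot a z0 <= dot a z].
  (* Each smaller positive value is smaller by at least [c - c'], so [m] bounds the number of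
     descents. *)
  have [m] : exists m : nat, dot a z0 < (c - c') *+ m.
    exists (Num.bound (dot a z0 / (c - c'))).
    rewrite -mulr_natl -ltr_pdivrMr ?subr_gt0//.
    by apply: archi_boundP; rewrite divr_ge0 ?subr_ge0// ltW.
  elim: m => [|m IH] in z0 z0Z z0_gt0 *.
    by rewrite mulr0n ltNge ltW.
  move=> z0m; have [[z [zZ z_gt0 zz0]]|nz] := pselect (exists z,
      [/\ integer_points z, 0 < dot a z & dot a z < dot a z0]).
    apply: (IH z) => //; have := gap _ (integer_pointsB _ _ z0Z zZ).
    by rewrite dotBr subr_gt0 => /(_ zz0); move: z0m; rewrite mulrS; lra.
  exists z0; split=> // z zZ z_gt0; rewrite leNgt; apply/negP => zz0.
  by apply: nz; exists z.
pose g := dot a z0; pose w : 'rV[int]_n := \row_i Num.floor (a 0 i / g).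
have aE i : a 0 i = g * (w 0 i)%:~R.
  rewrite mxE; have /andP[k1 k2] := floor_itv (a 0 i / g).
  set k := Num.floor _ in k1 k2 *.
  (* The remainder [a 0 i - k * g] is the value of [a] at an integer point and lies in [[0, g)], so
     it is zero by minimality. *)
  have := z0_min _ (integer_pointsB _ _ (integer_points_delta i)
    (integer_pointsZ k _ z0Z)).
  rewrite dotBr dot_delta dotZr subr_gt0 -/g.
  move: k1 k2; rewrite ler_pdivlMr// ltr_pdivrMr// intrD mulrDl mul1r => k1 k2.
  by rewrite [g * _]mulrC; case: ltgtP k1 => // k1 _ /(_ isT); lra.
have dotaE x : dot a x = g * dot (map_mx intr w) x.
  by rewrite /dot mulr_sumr; apply: eq_bigr => i _; rewrite aE !mxE mulrA.
exists w, (Num.floor (c' / g)); split.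
  by apply: contra_neq aj => w0; rewrite aE w0 mxE mulr0.
have /andP[k1 k2] := floor_itv (c' / g); set k := Num.floor _ in k1 k2 *.
move=> x; rewrite dotaE => xc' xc; apply/andP; split.
  by rewrite (le_lt_trans k1)// ltr_pdivrMr// mulrC.
rewrite ltNge; apply/negP => kx.
apply: (free _ (integer_pointsZ (k + 1) _ z0Z)); rewrite dotZr -/g.
  by rewrite -ltr_pdivrMr.
by apply: le_lt_trans xc; rewrite mulrC ler_pM2l.
Qed.

End IntegerFreeSlabs.

(** * Lattice subspaces from integer generators *)

Section LatticeSubspaces.
Context {R : realType} {n : nat}.
Implicit Types (L : {vspace 'rV[R]_n}) (s : seq 'rV[R]_n).

(** The hull of the integer points of [L] is stable under adding such points, hence real multiples
    of each generator, hence all vectors of the span. *)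
Lemma lattice_subspace_span s :
  (forall v, v \in s -> integer_points v) -> lattice_subspace (span s).
Proof.
move=> sZ; set L := span s; set Z := [set` L] `&` integer_points.
apply/seteqP; split.
  apply: conv_hull_min => [x y t /= xL yL _ _|x [] //].
  by rewrite memvD// memvZ.
have shift z x : Z z -> conv_hull Z x -> conv_hull Z (x + z).
  move=> [zL zZ]; move: x; apply: conv_hull_min => [x y t xZ yZ t0 t1|x [xL xZ]].
    have -> : t *: x + (1 - t) *: y + z = t *: (x + z) + (1 - t) *: (y + z).
      by rewrite !scalerDr addrACA -scalerDl subrKC scale1r.
    exact: conv_hull_convex.
  apply: sub_conv_hull; split; first by rewrite /= memvD.
  by move=> j; rewrite mxE rpredD.
(* [x + t v] lies between [x + floor t v] and [x + (floor t + 1) v]. *)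
have line t v x : v \in s -> conv_hull Z x -> conv_hull Z (x + t *: v).
  move=> vs xZ; have /andP[k1 k2] := floor_itv t; set k := Num.floor t in k1 k2.
  have kv (i : int) : conv_hull Z (x + i%:~R *: v).
    apply: shift => //; split; last exact: integer_pointsZ (sZ _ vs).
    by rewrite /= memvZ// memv_span.
  have -> : x + t *: v = (t - k%:~R) *: (x + (k + 1)%:~R *: v) +
      (1 - (t - k%:~R)) *: (x + k%:~R *: v).
    rewrite !scalerDr addrACA -scalerDl subrKC scale1r; congr (_ + _).
    by rewrite !scalerA -scalerDl; congr (_ *: _); rewrite intrD; ring.
  rewrite intrD in k2.
  apply: conv_hull_convex; [exact: kv|exact: kv|lra|lra].
have spanZ s' : {subset s' <= s} -> forall x y, conv_hull Z x ->
    y \in span s' -> conv_hull Z (x + y).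
  elim: s' => [|v s' IH] ss x y xZ.
    by rewrite span_nil memv0 => /eqP ->; rewrite addr0.
  rewrite span_cons => /memv_addP[_ /vlineP[t ->] [y' y's ->]]; rewrite addrA.
  apply: IH => // [u us|]; first by rewrite ss// inE us orbT.
  by apply: line => //; rewrite ss// mem_head.
move=> x xL; rewrite -[x]add0r; apply: (spanZ s) => //.
apply: sub_conv_hull; split; first exact: mem0v.
by move=> j; rewrite mxE rpred0.
Qed.

(** Unit vectors are adjoined one at a time; while the dimension is below [k <= n], some unit vector
    lies outside the span. *)
Lemma lattice_subspace_extend s (k : nat) :
  (forall v, v \in s -> integer_points v) -> (size s <= k <= n)%N ->
  exists2 L, lattice_subspaces k L & {subset s <= L}.
Proof.
move=> sZ /andP[sk kn].
have [t [tZ tk st]] : exists t, [/\ forall v, v \in t -> integer_points v,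
    \dim (span t) = k & {subset s <= t}].
  have : (\dim (span s) <= k)%N by apply: leq_trans sk; exact: dim_span.
  have [m] : exists m, (k - \dim (span s))%N = m by eexists.
  elim: m => [|m IH] in s sZ {sk} *.
    move/eqP; rewrite subn_eq0 => ks sk; exists s; split=> //.
    by apply/eqP; rewrite eqn_leq sk.
  move=> km sk; have sltk : (\dim (span s) < k)%N by rewrite -subn_gt0 km.
  have [j js] : exists j, delta_mx 0 j \notin span s.
    apply/existsP; apply: contraTT sltk; rewrite negb_exists -leqNgt => /forallP h.
    apply: leq_trans kn _; suff -> : span s = fullv.
      by rewrite dimvf /dim /= mul1n.
    apply/eqP; rewrite eqEsubv subvf; apply/subvP => x _.
    rewrite (row_sum_delta x) memv_suml// => j _.
    by rewrite memvZ//; have := h j; rewrite negbK.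
  have dimS : \dim (span (delta_mx 0 j :: s)) = (\dim (span s)).+1.
    have v0 : delta_mx 0 j != 0 :> 'rV[R]_n.
      by apply: contraNneq js => v0; rewrite v0 mem0v.
    rewrite span_cons dimv_disjoint_sum ?dim_vline ?v0//.
    apply/eqP; rewrite -subv0; apply/subvP => x.
    rewrite memv_cap => /andP[/vlineP[a ->]]; have [->|a0] := eqVneq a 0.
      by rewrite scale0r !mem0v.
    by rewrite rpredZeq (negPf a0) (negPf js).
  have [u us|||t [tZ tk st]] := IH (delta_mx 0 j :: s); rewrite ?dimS//.
  - by move: us; rewrite inE => /orP[/eqP ->|/sZ//]; exact: integer_points_delta.
  - by rewrite subnS km.
  by exists t; split=> // u us; rewrite st// inE us orbT.
exists (span t); first by split; [exact: lattice_subspace_span|].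
by move=> v /st; exact: memv_span.
Qed.

End LatticeSubspaces.

(** * Split sets: normal form, cylinders and strips *)

Section SplitSets.
Context {R : realType} {n : nat}.
Implicit Types (a b u v w x y z : 'rV[R]_n) (L V : {vspace 'rV[R]_n}).

Definition wedge_in L a c b d : set 'rV[R]_n :=
  ([set x | dot a x <= c] `&` [set` L]) `&`
  ([set x | dot b x <= d] `&` [set` L]).

(** As [a] and [b] lie in [L], an interior point may be pushed along them, which makes both
    inequalities strict. *)
Lemma int_in_wedge L a c b d x : a \in L -> b \in L -> a != 0 -> b != 0 ->
  x \in L -> int_in L (wedge_in L a c b d) x <-> dot a x < c /\ dot b x < d.
Proof.
move=> aL bL a0 b0 xL; split=> [xS|[ax bx]].
  split.
    have [e e0 [[/= + _] _]] := int_in_perturb _ _ _ a xL aL xS.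
    by rewrite dotDr dotZr; apply: lt_le_trans; rewrite ltrDl mulr_gt0// dot_gt0.
  have [e e0 [_ [/= + _]]] := int_in_perturb _ _ _ b xL bL xS.
  by rewrite dotDr dotZr; apply: lt_le_trans; rewrite ltrDl mulr_gt0// dot_gt0.
apply: (halfspaces_sub_int_in L _ a b c d) => // y yL ay byd.
by split; split=> //; exact: ltW.
Qed.

Lemma aff_full_dim L (S : set 'rV[R]_n) : S `<=` [set` L] ->
  has_dim S (\dim L) -> aff S = [set` L].
Proof.
move=> SL [p [V [_ VL affE]]]; rewrite affE.
have pVL : [set p + v | v in [set` V]] `<=` [set` L].
  rewrite -affE; apply: smallest_sub => //.
  exists 0, L; apply/seteqP; split=> [x xL|_ [v vL <-]]; last by rewrite add0r.
  by exists x => //; rewrite add0r.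
have pL : p \in L by apply: pVL; exists 0; [exact: mem0v | rewrite addr0].
have {}VL : V = L.
  apply/eqP; rewrite eqEdim VL leqnn andbT; apply/subvP => v vV.
  by rewrite -(addKr p v) memvD ?memvN//; apply: pVL; exists v.
apply/seteqP; split=> // x xL; exists (x - p); last by rewrite addrC subrK.
by rewrite /= VL memvB.
Qed.

Lemma has_dim_full L (S : set 'rV[R]_n) : S `<=` [set` L] -> S !=set0 ->
  (forall q V, S `<=` [set q + v | v in [set` V]] ->
    [set` L] `<=` [set q + v | v in [set` V]]) -> has_dim S (\dim L).
Proof.
move=> SL S0 affS; exists 0, L; split=> //.
have LE : [set 0 + v | v in [set` L]] = [set` L].
  apply/seteqP; split=> [_ [v vL <-]|x xL]; first by rewrite add0r.
  by exists x => //; rewrite add0r.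
apply/seteqP; split; first by apply: smallest_sub; [exists 0, L | rewrite LE].
by rewrite LE => x xL _ [[q [V ->]] SA]; exact: affS SA _ xL.
Qed.

(** The normals are replaced by their projections to [L]. A halfspace whose normal projects to 0
    contains [L], as [S] is nonempty, so the other one is used twice. *)
Lemma split_set_wedge L S : split_set L S ->
  exists a c b d, [/\ a \in L /\ a != 0, b \in L /\ b != 0 & S = wedge_in L a c b d].
Proof.
move=> [[_ [_ [[_ [a [c [_ ->]]] <-] [_ [b [d [_ ->]]] <-] SE]]] [p [V [[s Ss] _ _]]]
  Sfree].
have [a' a'L aa'] := orth_proj_exists L a; have [b' b'L bb'] := orth_proj_exists L b.
have aE x : x \in L -> dot a x = dot a' x.
  by move=> xL; rewrite dotC -(dot_orth_proj _ _ _ _ xL aa') dotC.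
have bE x : x \in L -> dot b x = dot b' x.
  by move=> xL; rewrite dotC -(dot_orth_proj _ _ _ _ xL bb') dotC.
have {}SE : S = wedge_in L a' c b' d.
  rewrite SE; apply/seteqP; split=> x [[/= h1 xL] [/= h2 _]].
    by split; split=> //=; rewrite -?aE -?bE.
  by split; split=> //=; rewrite ?aE ?bE.
have [[/= s1 sL] [/= s2 _]] : wedge_in L a' c b' d s by rewrite -SE.
have [a0|a0] := eqVneq a' 0; have [b0|b0] := eqVneq b' 0; last first.
- by exists a', c, b', d.
- exists a', c, a', c; split=> //; rewrite SE; apply/seteqP.
  split=> x [[/= h1 xL] [/= h2 _]]; do 2?split=> //=.
  by move: s2; rewrite b0 !dot0l.
- exists b', d, b', d; split=> //; rewrite SE; apply/seteqP.
  split=> x [[/= h1 xL] [/= h2 _]]; do 2?split=> //=.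
  by move: s1; rewrite a0 !dot0l.
(* If both normals project to 0, then [S = L], whose interior contains the lattice point 0. *)
suff : set0 (0 : 'rV[R]_n) by [].
rewrite -Sfree; split.
  rewrite int_inE ?mem0v// SE a0 b0.
  apply: filterE => x /= xL; rewrite a0 b0 !dot0l in s1 s2.
  by split; split; rewrite /= ?dot0l.
split; first exact: mem0v.
by exists 0 => [j|z _]; rewrite ?mxE ?rpred0// subrr dot0l.
Qed.

Lemma split_set_slab S : split_set fullv S ->
  exists (w : 'rV[int]_n) (K : int), w != 0 /\
    forall x, int_in fullv S x ->
      K%:~R < dot (map_mx intr w) x < (K + 1)%:~R.
Proof.
move=> splitS; have [a [c [b [d [[_ a0] [_ b0] SE]]]]] := split_set_wedge _ _ splitS.
have intS x : int_in fullv S x <-> dot a x < c /\ dot b x < d.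
  rewrite SE; exact: int_in_wedge (memvf _) (memvf _) a0 b0 (memvf _).
have free z : integer_points z -> dot a z < c -> dot b z < d -> False.
  move=> zZ az bz; suff : set0 z by [].
  by case: splitS => _ _ <-; rewrite proj_lattice_fullv; split=> //; apply/intS.
have [|mu mu0 bE] := no_common_descent _ _ a0 b0.
  by move=> v av bv; have [z [zZ az bz]] := wedge_integer_point _ _ _ c d av bv;
    exact: free zZ az bz.
have bd x : dot b x < d <-> - d / mu < dot a x.
  by rewrite bE dotZl ltr_pdivrMr// mulNr ltrNl mulrC.
have [|w [K [w0 wK]]] := integer_free_slab _ c (- d / mu) a0.
  by move=> z zZ /bd bz az; exact: free zZ az bz.
by exists w, K; split=> // x /intS[ax /bd bx]; exact: wK.
Qed.

Lemma split_set_cylinder L S : split_set L S -> exists2 S', split_set fullv S' &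
  forall p u, u \in L -> orth_compl L (p - u) ->
    int_in fullv S' p <-> int_in L S u.
Proof.
move=> splitS; have [a [c [b [d [[aL a0] [bL b0] SE]]]]] := split_set_wedge _ _ splitS.
have intE p u : u \in L -> orth_compl L (p - u) ->
    int_in fullv (wedge_in fullv a c b d) p <-> int_in L S u.
  move=> uL pu; rewrite SE.
  have -> := int_in_wedge fullv a c b d p (memvf _) (memvf _) a0 b0 (memvf _).
  have -> := int_in_wedge L a c b d u aL bL a0 b0 uL.
  by rewrite !(dot_orth_proj L _ p u).
exists (wedge_in fullv a c b d); last exact: intE.
have [_ Sdim Sfree] := splitS.
have SS' : S `<=` wedge_in fullv a c b d.
  by rewrite SE => x [[h1 _] [h2 _]]; split; split=> //; exact: memvf.
have SL : S `<=` [set` L] by rewrite SE => x [[]].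
split.
- exists ([set x | dot a x <= c] `&` [set` fullv]).
  exists ([set x | dot b x <= d] `&` [set` fullv]).
  split=> //; first by exists [set x | dot a x <= c] => //; exists a, c.
  by exists [set x | dot b x <= d] => //; exists b, d.
(* An affine subspace containing the cylinder contains the affine hull [L] of [S], so it is the
   linear space [V]; and [x - u] lies in [V] because [s] and [s + (x - u)] are in the cylinder. *)
- have [p [V0 [[s Ss] _ _]]] := Sdim.
  apply: has_dim_full => [x _||q V S'V x _]; first exact: memvf.
    by exists s; exact: SS'.
  have LV : [set` L] `<=` [set q + v | v in [set` V]].
    rewrite -(aff_full_dim _ _ SL Sdim); apply: smallest_sub.
      by exists q, V.
    exact: subset_trans S'V.
  have [v vV qv] := LV 0 (mem0v L).
  have qV : q \in V by move/eqP: qv; rewrite addr_eq0 => /eqP ->; rewrite memvN.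
  have inV y : [set q + v | v in [set` V]] y -> y \in V.
    by move=> [v' v'V <-]; exact: (memvD qV v'V).
  have [u uL xu] := orth_proj_exists L x.
  exists (x - q); last by rewrite addrC subrK.
  have uV : u \in V by apply: inV; exact: LV.
  have sV : s \in V by apply: inV; apply: LV; exact: SL.
  have sx : s + (x - u) \in V.
    apply: inV; apply: S'V; have := Ss; rewrite SE => -[[/= h1 sL] [/= h2 _]].
    by split; split; rewrite /= ?memvf// dotDr (dotC _ (x - u)) xu// addr0.
  have -> : x = (s + (x - u)) - s + u by rewrite [s + _]addrC addrK subrK.
  by rewrite /= memvB// memvD// memvB.
- apply/seteqP; split=> // z [zS']; rewrite proj_lattice_fullv => zZ.
  have [u uL zu] := orth_proj_exists L z.
  suff : set0 u by [].
  rewrite -Sfree; split; first exact/(intE z u uL zu).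
  by split=> //; exists z.
Qed.

Lemma split_set_strip L w (K : int) : w \in L -> w != 0 -> integer_points w ->
  split_set L (wedge_in L w (K + 1)%:~R (- w) (- K)%:~R).
Proof.
move=> wL w0 wZ; have ww : 0 < dot w w by rewrite dot_gt0.
have intE y : y \in L ->
    int_in L (wedge_in L w (K + 1)%:~R (- w) (- K)%:~R) y <->
    dot w y < (K + 1)%:~R /\ dot (- w) y < (- K)%:~R.
  by apply: int_in_wedge; rewrite ?memvN ?oppr_eq0.
split.
- exists ([set x | dot w x <= (K + 1)%:~R] `&` [set` L]).
  exists ([set x | dot (- w) x <= (- K)%:~R] `&` [set` L]).
  split=> //; first by exists [set x | dot w x <= (K + 1)%:~R] => //; exists w, (K + 1)%:~R.
  exists [set x | dot (- w) x <= (- K)%:~R] => //.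
  by exists (- w), (- K)%:~R; rewrite oppr_eq0.
(* The middle of the strip: [dot w p = K + 1/2]. *)
- pose p := ((K%:~R + 2^-1) / dot w w) *: w.
  have pL : p \in L by rewrite memvZ.
  have pint : int_in L (wedge_in L w (K + 1)%:~R (- w) (- K)%:~R) p.
    rewrite intE// dotNl /p dotZr divfK ?gt_eqF//.
    rewrite intrD rmorphN; split; lra.
  apply: has_dim_full => [x [[]]//||q V SV x xL].
    by exists p; have [e _] := int_in_perturb _ _ _ 0 pL (mem0v L) pint;
      rewrite scaler0 addr0.
  have [e e0 Sx] := int_in_perturb _ _ _ (x - p) pL (memvB xL pL) pint.
  have [v1 v1V E1] : [set q + v | v in [set` V]] p.
    apply: SV; have [e' _] := int_in_perturb _ _ _ 0 pL (mem0v L) pint.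
    by rewrite scaler0 addr0.
  have [v2 v2V E2] := SV _ Sx.
  exists (v1 + e^-1 *: (v2 - v1)); first by rewrite /= memvD// memvZ// memvB.
  have -> : v2 - v1 = e *: (x - p).
    by apply: (addrI (q + v1)); rewrite addrACA subrr addr0 E2 E1.
  by rewrite scalerA mulVf ?gt_eqF// scale1r addrA E1 addrC subrK.
(* [dot w y] equals the integer [dot w z], which cannot lie strictly between [K] and [K + 1]. *)
- apply/seteqP; split=> // y [yint [yL [z zZ zy]]].
  move: yint; rewrite intE// dotNl (dot_orth_proj _ _ _ _ wL zy).
  have /intrP[m ->] := dot_int _ _ wZ zZ.
  by rewrite -rmorphN !ltr_int ltrN2; lia.
Qed.

End SplitSets.

Theorem theorem2p8 (R : realType) (n k : nat) (hn : (2 <= n)%N)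
    (hk : (2 <= k <= n)%N) (P : set 'rV[R]_n) (hP : rational_polyhedron P) :
  split_closure P =
  \bigcap_(L in lattice_subspaces k)
    [set x + y | x in split_closure_in L P & y in orth_compl L].
Proof.
apply/seteqP; split=> [x xP L _|x xL S splitS].
  have [u uL xu] := orth_proj_exists L x.
  exists u; last by exists (x - u) => //; rewrite addrC subrK.
  move=> S /split_set_cylinder[S' splitS' intE].
  pose C := conv_hull (orth_proj L P `\` int_in L S).
  (* Having a projection in [C] is a convex condition on [x], so it is checked only on points of [P]
     outside the interior of the cylinder. *)
  suff [v [vL xv Cv]] : exists v, [/\ v \in L, orth_compl L (x - v) & C v].
    by rewrite (orth_compl_uniq _ _ _ _ uL vL xu xv).
  have {xP u uL xu} := xP S' splitS'; move: x.
  rewrite orth_proj_fullv; apply: conv_hull_min.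
    move=> x y t [u [uL xu Cu]] [v [vL yv Cv]] t0 t1.
    exists (t *: u + (1 - t) *: v); split.
    - by rewrite memvD// memvZ.
    - move=> z zL; rewrite opprD addrACA -!scalerBr dotDl !dotZl xu// yv//.
      by rewrite !mulr0 addr0.
    - exact: conv_hull_convex.
  move=> p [Pp pS']; have [u uL pu] := orth_proj_exists L p.
  exists u; split=> //; apply: sub_conv_hull; split.
    by split=> //; exists p.
  by move/(intE p u uL pu).
have [w [K [w0 wK]]] := split_set_slab _ splitS.
pose wr : 'rV[R]_n := map_mx intr w.
have wrE : ratv (map_mx intr w) = wr.
  by apply/rowP => j; rewrite !mxE ratr_int.
have wrZ : integer_points wr by move=> j; rewrite mxE intr_int.
have wr0 : wr != 0.
  apply: contra_neq w0 => wr0; apply/rowP => j.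
  by move/rowP: wr0 => /(_ j); rewrite !mxE => /eqP; rewrite intr_eq0 => /eqP.
have [|Q [[I [f [fra QE]]] PQ Qconv]] :=
  @split_hull R n P (map_mx intr w) K%:~R (K + 1)%:~R hP; first by rewrite ltr_int ltrDl.
rewrite wrE !ratr_int in PQ Qconv.
(* The interior of [S] lies in the open strip, so the part of [P] outside the strip, whose hull
   contains [Q], also avoids that interior. *)
suff : Q x.
  move/Qconv; apply: conv_hull_mono => y [Py yw]; split.
    by rewrite orth_proj_fullv.
  by move=> /wK; rewrite -/wr => /andP[h1 h2]; case: yw; rewrite leNgt ?h1 ?h2.
rewrite QE => i; have [c [b fE]] := fra i.
(* Clearing denominators turns the normal [c] of this inequality into an integer vector. *)
have [m m0 [cz czE]] : exists2 m : rat, 0 < m & exists cz : 'rV[int]_n,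
    m *: c = map_mx intr cz.
  exists (\prod_j denq (c 0 j))%:~R.
    by rewrite ltr0z prodr_gt0// => j _; exact: denq_gt0.
  exists (\row_j (numq (c 0 j) * \prod_(i | i != j) denq (c 0 i))).
  apply/rowP => j; rewrite !mxE (bigD1 j)//= !intrM mulrAC; congr (_ * _).
  by rewrite mulrC numqE.
pose cr : 'rV[R]_n := map_mx intr cz.
have crE : cr = ratr m *: ratv c.
  rewrite /ratv -map_mxZ czE; by apply/rowP => j; rewrite !mxE /= ratr_int.
(* Two integer vectors, possibly dependent, fit into dimension [k] because [2 <= k]. *)
have [||L Llat sL] := @lattice_subspace_extend R n [:: wr; cr] k.
- move=> v; rewrite !inE => /orP[] /eqP -> //.
  by move=> j; rewrite mxE intr_int.
- exact: hk.
have wL : wr \in L by rewrite sL// mem_head.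
have cL : ratv c \in L.
  have : cr \in L by rewrite sL// !inE eqxx orbT.
  by rewrite crE rpredZeq fmorph_eq0 (gt_eqF m0).
have [u uS [y yL <-]] := xL L Llat.
rewrite fE dotDr (dotC _ y) yL// addr0 subr_le0.
(* It is enough to bound [c] on projections [v] of points [p] of [P], with [v] outside the open
   strip. Then [p] is outside as well, so it lies in [Q], and [c], being in [L], takes the same
   value at [v] and [p]. *)
apply: conv_hull_halfspace (uS _ (split_set_strip L wr K wL wr0 wrZ)).
move=> v [[vL [p Pp pv]] vint].
have : Q p.
  apply: PQ; split=> //; rewrite /= -(dot_orth_proj _ _ _ _ wL pv).
  have [h1|h1] := leP (dot wr v) K%:~R; first by left.
  right; rewrite leNgt; apply/negP => h2; apply: vint.
  apply/int_in_wedge; rewrite ?memvN ?oppr_eq0//; split=> //.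
  by rewrite dotNl rmorphN ltrN2.
by rewrite QE => /(_ i); rewrite fE /= (dot_orth_proj _ _ _ _ cL pv) subr_le0.
Qed.
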